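(* Let $A\in\mathcal{S}_n^{+}$. Then the following statements hold: (a) for each $k\in\{1,2\}$, $\operatorname{rk}(A)=k$ if and only if $\operatorname{st}_{+}(A)=k$; (b) if $\operatorname{st}_{+}(A)=3$, then $\operatorname{rk}(A)=3$.
   Context: Here $\mathbb{R}_{+}^{m\times n}$ is the set of $m\times n$ real matrices with nonnegative entries and $\mathcal{S}_n^{+}$ is the set of symmetric $n\times n$ matrices with nonnegative entries. $\operatorname{rk}$ is the usual rank. For $A\in\mathcal{S}_n^{+}$, an SN-Trifactorization of $A$ is a factorization $A=BCB^{T}$ with $B\in\mathbb{R}_{+}^{n\times k}$ and $C\in\mathcal{S}_k^{+}$; the SNT-rank $\operatorname{st}_{+}(A)$ is the smallest integer $k$ for which such a factorization exists, with the convention $\operatorname{st}_{+}(0)=0$. *)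

(* Defs.v *)
From mathcomp Require Import all_boot all_order all_algebra.
From mathcomp Require Import boolp reals.

Set Implicit Arguments.
Unset Strict Implicit.
Unset Printing Implicit Defensive.

Import Order.TTheory GRing.Theory Num.Theory.

Local Open Scope ring_scope.

Definition nonneg_mx (R : realType) (m n : nat) (A : 'M[R]_(m, n)) : Prop :=
  forall i j, 0 <= A i j.

Definition sym_nonneg_mx (R : realType) (n : nat) (A : 'M[R]_n) : Prop :=
  A^T = A /\ nonneg_mx A.

Definition is_SN_trifactorization (R : realType) (n k : nat) (A : 'M[R]_n)
    (B : 'M[R]_(n, k)) (C : 'M[R]_k) : Prop :=
  [/\ nonneg_mx B, sym_nonneg_mx C & A = B *m C *m B^T].

Definition has_SN_trifactorization (R : realType) (n : nat) (A : 'M[R]_n)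
    (k : nat) : Prop :=
  exists (B : 'M[R]_(n, k)) (C : 'M[R]_k), is_SN_trifactorization A B C.

(* The trivial factorization A = I A I^T, of inner size n. *)
Lemma exists_SN_trifactorization (R : realType) (n : nat) (A : 'M[R]_n) :
  sym_nonneg_mx A -> exists k, `[< has_SN_trifactorization A k >].
Proof.
move=> hA; exists n; apply/asboolP; exists 1%:M, A; split=> //.
  by move=> i j; rewrite mxE ler0n.
by rewrite trmx1 mul1mx mulmx1.
Qed.

(* Sizes k = 0 are allowed: an n x 0 by 0 x 0 by 0 x n product is the zero
   matrix, which yields the convention st_+(0) = 0 (see snt_rank0). *)
Definition snt_rank (R : realType) (n : nat) (A : 'M[R]_n)
    (hA : sym_nonneg_mx A) : nat :=
  ex_minn (exists_SN_trifactorization hA).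

Lemma snt_rank0 (R : realType) (n : nat) (h0 : sym_nonneg_mx (0 : 'M[R]_n)) :
  snt_rank h0 = 0%N.
Proof.
rewrite /snt_rank; case: ex_minnP => k _ /(_ 0%N) min_k.
apply/eqP; rewrite -leqn0; apply/min_k/asboolP.
exists 0, 0; split; first by move=> i j; rewrite mxE.
  by split; [rewrite trmx0 | move=> i j; rewrite mxE].
by rewrite !mul0mx.
Qed.

(* Main.v *)
(* The rank of a factorization B C B^T of inner size k is at most k, so it is
   enough to show st_+(A) <= rk(A) when rk(A) <= 2.  In that case the cone
   generated by the rows of A has at most rk(A) extreme rays, each of them
   spanned by a row of A: A = H E A with H >= 0 and E selecting the extreme
   rows.  Transposing, A = A E^T H^T, hence A = H (E A E^T) H^T. *)
Require Import Defs.
From mathcomp Require Import all_boot all_order all_algebra.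
From mathcomp Require Import boolp reals.
From mathcomp Require Import ring.

Set Implicit Arguments.
Unset Strict Implicit.
Unset Printing Implicit Defensive.

Import Order.TTheory GRing.Theory Num.Theory.

Local Open Scope ring_scope.

Lemma rank_factorization (F : fieldType) (m n k : nat) (A : 'M[F]_(m, n)) :
  \rank A = k -> exists (U : 'M[F]_(m, k)) (V : 'M[F]_(k, n)), A = U *m V.
Proof. by move=> <-; exists (col_base A), (row_base A); rewrite mulmx_base. Qed.

(** The middle factor is [mxsub f f A], which inherits symmetry and nonnegativity from [A]. *)
Lemma SN_trifactorization_rowsub (R : realType) (n k : nat) (A : 'M[R]_n)
    (f : 'I_k -> 'I_n) (H : 'M[R]_(n, k)) :
  sym_nonneg_mx A -> nonneg_mx H -> A = H *m rowsub f A ->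
  has_SN_trifactorization A k.
Proof.
move=> [symA A_ge0] H_ge0 AE; exists H, (mxsub f f A); split=> //.
  split; last by move=> i j; rewrite mxE.
  by rewrite trmx_mxsub symA.
have AE' : rowsub f A = mxsub f f A *m H^T.
  rewrite -{1}symA {1}AE trmx_mul -mul_rowsub_mx; congr (_ *m _).
  by apply/matrixP => i j; rewrite !mxE -{1}symA mxE.
by rewrite -mulmxA -AE'.
Qed.

Section NonnegRows.
Variables (R : realType) (m n : nat) (A : 'M[R]_(m, n)).
Hypothesis A_ge0 : nonneg_mx A.

Definition row_sum (i : 'I_m) : R := \sum_j A i j.

Lemma row_sum_ge0 i : 0 <= row_sum i.
Proof. exact: sumr_ge0. Qed.

Lemma row_sum_eq0 i : row_sum i = 0 -> forall j, A i j = 0.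
Proof.
move/eqP; rewrite psumr_eq0 // => /allP si0 j.
by apply/eqP/si0; rewrite mem_index_enum.
Qed.

Lemma row_sum_gt0 : A != 0 -> exists i, 0 < row_sum i.
Proof.
move=> A_neq0; case: (pickP (fun i => 0 < row_sum i)) => [i si | s_le0].
  by exists i.
case/eqP: A_neq0; apply/matrixP => i j; rewrite mxE row_sum_eq0 //.
by apply/le_anti; rewrite row_sum_ge0 leNgt s_le0.
Qed.

Lemma row_sum_mulmx k (U : 'M[R]_(m, k)) (V : 'M[R]_(k, n)) i :
  A = U *m V -> row_sum i = \sum_l U i l * \sum_j V l j.
Proof.
move=> AE; rewrite /row_sum AE; under eq_bigr do rewrite mxE.
by rewrite exchange_big; apply: eq_bigr => l _; rewrite mulr_sumr.
Qed.

(** All rows are multiples of the single row of [V], so any row with positive sum generates the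
    others; the coefficients are quotients of row sums, hence nonnegative. *)
Lemma nonneg_rank1_extreme_row (U : 'M[R]_(m, 1)) (V : 'M[R]_(1, n)) :
  A != 0 -> A = U *m V ->
  exists p (H : 'M[R]_(m, 1)), nonneg_mx H /\ A = H *m rowsub (fun=> p) A.
Proof.
move=> /row_sum_gt0 [p sp_gt0] AE.
exists p, (\col_i (row_sum i / row_sum p)); split.
  by move=> i j; rewrite mxE divr_ge0 ?row_sum_ge0.
apply/matrixP => i j; rewrite !mxE big_ord1 !mxE.
(* In coordinates [row_sum p] is the product of [U p 0] and the sum of [V], so neither factor
   vanishes and both can be cancelled. *)
move/lt0r_neq0: sp_gt0; rewrite !(row_sum_mulmx _ AE) AE !mxE !big_ord1.
by rewrite mulf_eq0 negb_or => /andP[Up sV]; field; rewrite Up sV.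
Qed.

(* The points [t i / row_sum i] parametrize the rows normalized to row sum 1,
   which lie on a line; [p] and [q] are the extreme points. *)
Lemma nonneg_collinear_extreme_rows (t : 'I_m -> R) (a b : 'I_n -> R) :
  A != 0 -> (forall i j, A i j = a j * row_sum i + b j * t i) ->
  exists p q (x y : 'I_m -> R), (forall i, 0 <= x i /\ 0 <= y i) /\
    (forall i j, A i j = x i * A p j + y i * A q j).
Proof.
move=> /row_sum_gt0 [i0 si0] AE.
(* On a zero row the division returns 0, a value without meaning; the extrema below therefore range
   only over rows of positive sum. *)
pose r i := t i / row_sum i.
have [p sp rp] := @arg_minP _ _ _ i0 (fun i => 0 < row_sum i) r si0.
have [q sq rq] := @arg_maxP _ _ _ i0 (fun i => 0 < row_sum i) r si0.
suff /choice [x /choice [y xyP]] : forall i, exists x y,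
    [/\ 0 <= x, 0 <= y & forall j, A i j = x * A p j + y * A q j].
  by exists p, q, x, y; split=> i; case: (xyP i).
move=> i; have [si_gt0|] := ltP 0 (row_sum i); last first.
  move=> si_le0; exists 0, 0; split=> // j.
  by rewrite row_sum_eq0 ?mul0r ?addr0 //; apply/le_anti; rewrite si_le0 row_sum_ge0.
have tE k : 0 < row_sum k -> t k = r k * row_sum k.
  by move=> /lt0r_neq0 sk; rewrite /r divfK.
have AE' k j : 0 < row_sum k -> A k j = (a j + b j * r k) * row_sum k.
  by move=> sk; rewrite AE tE //; ring.
have rpi := rp i si_gt0; have riq : r i <= r q := rq i si_gt0.
(* If the extreme points coincide, all nonzero rows are proportional to row [p]. *)
have [rpq|rpq] := eqVneq (r p) (r q).
  exists (row_sum i / row_sum p), 0; split=> // [|j].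
    by rewrite divr_ge0 ?row_sum_ge0.
  have rip : r i = r p by apply/le_anti; rewrite rpi rpq riq.
  by rewrite !AE' // rip mul0r addr0; field; rewrite lt0r_neq0.
have dpq : 0 < r q - r p.
  by rewrite subr_gt0 lt_neqAle rpq (le_trans rpi).
(* Barycentric coordinates of [r i] in the segment from [r p] to [r q], rescaled by ratios of row
   sums to undo the normalization. *)
exists ((r q - r i) / (r q - r p) * (row_sum i / row_sum p)),
  ((r i - r p) / (r q - r p) * (row_sum i / row_sum q)); split=> [||j].
- by rewrite !mulr_ge0 ?invr_ge0 ?subr_ge0 ?row_sum_ge0 // ltW // -subr_gt0.
- by rewrite !mulr_ge0 ?invr_ge0 ?subr_ge0 ?row_sum_ge0 // ltW // -subr_gt0.
by rewrite !AE' //; field; rewrite !lt0r_neq0.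
Qed.

Lemma nonneg_rank2_extreme_rows (U : 'M[R]_(m, 2)) (V : 'M[R]_(2, n)) :
  A != 0 -> A = U *m V ->
  exists (f : 'I_2 -> 'I_m) (H : 'M[R]_(m, 2)),
    nonneg_mx H /\ A = H *m rowsub f A.
Proof.
move=> A_neq0 AE.
pose c := \sum_j V ord0 j; pose d := \sum_j V (lift ord0 ord0) j.
have sE i : row_sum i = U i ord0 * c + U i (lift ord0 ord0) * d.
  by rewrite (row_sum_mulmx _ AE) !big_ord_recl big_ord0 addr0.
(* If [c] and [d] both vanished, every row sum would be zero, although [A] has a row of positive
   sum. *)
have cd_neq0 : c ^+ 2 + d ^+ 2 != 0.
  have [i] := row_sum_gt0 A_neq0; rewrite sE; apply: contraTneq => /eqP.
  rewrite paddr_eq0 ?sqr_ge0 // !sqrf_eq0 => /andP[/eqP-> /eqP->].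
  by rewrite !mulr0 addr0 ltxx.
(* [row_sum] and [t] span the column space of [U], as c ^+ 2 + d ^+ 2 != 0. *)
pose t i := U i (lift ord0 ord0) * c - U i ord0 * d.
(* The passage from the two columns of [U] to [row_sum] and [t] has determinant [c ^+ 2 + d ^+ 2];
   [a] and [b] come from inverting it. *)
pose a j := (c * V ord0 j + d * V (lift ord0 ord0) j) / (c ^+ 2 + d ^+ 2).
pose b j := (c * V (lift ord0 ord0) j - d * V ord0 j) / (c ^+ 2 + d ^+ 2).
have AEab i j : A i j = a j * row_sum i + b j * t i.
  rewrite sE /a /b /t {1}AE mxE !big_ord_recl big_ord0.
  by field.
have [p [q [x [y [xy_ge0 xyE]]]]] :=
  nonneg_collinear_extreme_rows A_neq0 AEab.
exists (fun l => if l == ord0 then p else q).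
exists (\matrix_(i, l) if l == ord0 then x i else y i); split.
  by move=> i l; rewrite mxE; case: ifP; case: (xy_ge0 i).
by apply/matrixP => i j; rewrite mxE !big_ord_recl big_ord0 !mxE /= addr0.
Qed.

End NonnegRows.

Section SNTRank.
Variables (R : realType) (n : nat) (A : 'M[R]_n).
Hypothesis hA : sym_nonneg_mx A.

Lemma rank_le_snt_rank : (\rank A <= snt_rank hA)%N.
Proof.
rewrite /snt_rank; case: ex_minnP => k /asboolP [B [C [_ _ ->]]] _.
by rewrite -mulmxA (leq_trans (mxrankM_maxl _ _)) ?rank_leq_col.
Qed.

Lemma snt_rank_le k : has_SN_trifactorization A k -> (snt_rank hA <= k)%N.
Proof.
by move=> Ak; rewrite /snt_rank; case: ex_minnP => l _; apply; apply/asboolP.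
Qed.

Lemma snt_rank_low_rank : (\rank A <= 2)%N -> snt_rank hA = \rank A.
Proof.
move=> rA; apply/eqP; rewrite eqn_leq rank_le_snt_rank andbT.
(* The zero matrix has no row of positive sum to start from, so it is settled by the convention for
   size 0. *)
have [A0|A_neq0] := eqVneq A 0.
  by move: hA; rewrite A0 => h0; rewrite snt_rank0.
apply: snt_rank_le; case rAE: (\rank A) rA => [|[|[|]]] // _.
- by move/eqP: rAE; rewrite mxrank_eq0 (negPf A_neq0).
- have [U [V AE]] := rank_factorization rAE.
  have [p [H [H_ge0 AH]]] := nonneg_rank1_extreme_row hA.2 A_neq0 AE.
  exact: SN_trifactorization_rowsub hA H_ge0 AH.
- have [U [V AE]] := rank_factorization rAE.
  have [f [H [H_ge0 AH]]] := nonneg_rank2_extreme_rows hA.2 A_neq0 AE.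
  exact: SN_trifactorization_rowsub hA H_ge0 AH.
Qed.

(** A rank above 2 is squeezed between 3 and [snt_rank hA], which is at most 3; a smaller rank
    already equals the SNT-rank. *)
Lemma rank_small_snt_rank : (snt_rank hA <= 3)%N -> \rank A = snt_rank hA.
Proof.
move=> st3; have [/snt_rank_low_rank // | rA] := leqP (\rank A) 2.
by apply/eqP; rewrite eqn_leq rank_le_snt_rank (leq_trans st3).
Qed.

End SNTRank.

Theorem proposition2p7 (R : realType) (n : nat) (A : 'M[R]_n)
    (hA : sym_nonneg_mx A) :
  (forall k : nat, k = 1%N \/ k = 2%N -> (\rank A = k <-> snt_rank hA = k)) /\
  (snt_rank hA = 3%N -> \rank A = 3%N).
Proof.
split=> [k k12|st3]; last by rewrite (rank_small_snt_rank (hA := hA)) st3.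
have k2 : (k <= 2)%N by case: k12 => ->.
split=> [rA|stA]; first by rewrite snt_rank_low_rank rA.
by rewrite (rank_small_snt_rank (hA := hA)) stA // ltnW.
Qed.
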